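(* Let $a,b$ be relatively prime positive integers and let $\mathfrak{Z}=\{(\zeta(P),\eta(P)) : P\in\mathfrak{D}_{a,b}\}$ be the set of admissible pairs. For every $(Q,R)\in\mathfrak{Z}$ the permutation $\gamma=\gamma_{Q,R}$ of $\{1,\dots,a+b\}$ is a cycle permutation (a single cycle of length $a+b$), and the map $\iota:\mathfrak{Z}\to\mathfrak{D}_{a,b}$ is the inverse of the map $(\zeta,\eta):\mathfrak{D}_{a,b}\to\mathfrak{Z}$, $P\mapsto(\zeta(P),\eta(P))$; that is, $\iota(\zeta(P),\eta(P))=P$ for every $P\in\mathfrak{D}_{a,b}$ and $(\zeta(\iota(Q,R)),\eta(\iota(Q,R)))=(Q,R)$ for every $(Q,R)\in\mathfrak{Z}$.
   Context: Let $a,b$ be relatively prime positive integers. An $(a,b)$-Dyck path is a lattice path from $(0,0)$ to $(b,a)$ with unit north steps and unit east steps, all of whose lattice points $(x,y)$ satisfy $ax\le by$; it is drawn in the grid with $a$ rows and $b$ columns. $\mathfrak{D}_{a,b}$ is the set of all of them. Hooks and cores: the unit box with southeast corner $(x,y)$ has hook filling $by-ax$. The positive hooks of $P$ are the positive hook fillings of the boxes of the grid lying below (southeast of) $P$. $\mathfrak{c}(P)$ is the partition whose set of first-column hook lengths is the set of positive hooks of $P$ (it is an $(a,b)$-core, i.e. has no hook length equal to $a$ or $b$). For a partition $\kappa$ and a positive integer $m$: consider the hook lengths of the boxes in the first column of $\kappa$; for each residue modulo $m$ that occurs take the largest such hook length; the rows of $\kappa$ with these first-column hook lengths are the $m$-rows.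 The $m$-boundary of $\kappa$ is the set of boxes with hook length less than $m$. Zeta and eta: the partition bounded by a path in the grid is the partition whose Young diagram (English notation) is the set of boxes of the grid above (northwest of) the path. $\lambda(P)=(\lambda_1\ge\dots\ge\lambda_a)$ has as parts the numbers of $b$-boundary boxes in the $a$-rows of $\mathfrak{c}(P)$ (padded with zeros), and $\mu(P)=(\mu_1\ge\dots\ge\mu_b)$ has as parts the numbers of $a$-boundary boxes in the $b$-rows of $\mathfrak{c}(P)$ (padded with zeros). $\zeta(P)$ is the $(a,b)$-Dyck path bounding $\lambda(P)$, and $\eta(P)$ is the $(a,b)$-Dyck path bounding the conjugate partition of $\mu(P)$. The map $\iota$: let $(Q,R)\in\mathfrak{Z}$. (1) Draw $Q$ in the grid, and rotate $R$ by $180^\circ$ so that it becomes a path from $(0,0)$ to $(b,a)$ below the diagonal. Label the steps of each of these two paths by $1,\dots,a+b$ in order from the bottom-left corner to the top-right corner. (2) Define $\gamma=\gamma_{Q,R}:\{1,\dots,a+b\}\to\{1,\dots,a+b\}$: if $l$ labels a horizontal step of $Q$, $\gamma(l)$ is the label of the horizontal step of rotated $R$ in the same column; if $l$ labels a vertical step of $Q$, $\gamma(l)$ is the label of the vertical step of rotated $R$ in the same row. (3) When $\gamma$ is a single cycle, write it in cycle notation as $(\sigma_1,\sigma_2,\dots,\sigma_{a+b})$ with $\sigma_1=1$ (so $\sigma_{i+1}=\gamma(\sigma_i)$). Then $\iota(Q,R)$ is the path whose $i$-th step is east if $i$ is a cyclic descent of the sequence $\sigma$ (i.e. $\sigma_i>\sigma_{i+1}$,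 indices modulo $a+b$) and north otherwise. *)

(* Defs.v *)
From mathcomp Require Import all_boot all_fingroup.

Set Implicit Arguments.
Unset Strict Implicit.
Unset Printing Implicit Defensive.

(** * Lattice paths *)

(* A lattice path starting at (0, 0) is the word of its unit steps. *)
Definition north : bool := true.
Definition east : bool := false.

(* [(easts w k, norths w k)] is the lattice point reached after [k] steps. *)
Definition easts (w : seq bool) (k : nat) : nat := count_mem east (take k w).
Definition norths (w : seq bool) (k : nat) : nat := count_mem north (take k w).

Definition dyck (a b : nat) : pred (seq bool) := fun w =>
  [&& count_mem east w == b, count_mem north w == a &
      all (fun k => a * easts w k <= b * norths w k) (iota 0 (size w).+1)].

(** * Partitions, written as nonincreasing sequences of positive parts *)

(* Hook length of the box in row [i] and column [j] (both counted from 0); the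
   first summand is arm + 1, the second one is the leg. *)
Definition hook (kappa : seq nat) (i j : nat) : nat :=
  (nth 0 kappa i - j) + count (fun p => j < p) (drop i.+1 kappa).

Definition first_column_hooks (kappa : seq nat) : seq nat :=
  [seq hook kappa i 0 | i <- iota 0 (size kappa)].

Definition conjugate (kappa : seq nat) : seq nat :=
  mkseq (fun j => count (fun p => j < p) kappa) (\max_(p <- kappa) p).

(* The partition whose set of first-column hook lengths is [H]; see
   [partition_of_hooksP]. *)
Definition partition_of_hooks (H : seq nat) : seq nat :=
  let h := sort geq H in
  mkseq (fun i => nth 0 h i - (size h - i.+1)) (size h).

Lemma partition_of_hooksP (H : seq nat) :
    uniq H -> all (leq 1) H ->
  [/\ sorted geq (partition_of_hooks H), all (leq 1) (partition_of_hooks H)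
    & first_column_hooks (partition_of_hooks H) = sort geq H].
Proof.
move=> uH pH; rewrite /partition_of_hooks; set h := sort geq H.
set k := mkseq _ _.
have szk : size k = size h by rewrite size_mkseq.
have pos i : i < size h -> 0 < nth 0 h i.
  by move=> lti; apply: (allP pH); rewrite -(mem_sort geq) mem_nth.
have sh : sorted geq h by apply: sort_sorted => x y; rewrite /= leq_total.
have uh : uniq h by rewrite sort_uniq.
have step i : i.+1 < size h -> nth 0 h i.+1 < nth 0 h i.
  move=> lti; rewrite ltn_neqAle nth_uniq ?(ltnW lti) // gtn_eqF //=.
  by have /(sortedP 0)/(_ i lti) := sh.
have big n i : i + n.+1 = size h -> n < nth 0 h i.
  elim: n i => [|n IHn] i e; first by apply: pos; rewrite -e addn1.
  rewrite addnS -addSn in e.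
  by apply: leq_ltn_trans (IHn _ e) (step _ _); rewrite -e addnS ltnS leq_addr.
have big' i : i < size h -> size h - i.+1 < nth 0 h i.
  by move=> lti; apply: big; rewrite -addSnnS subnKC.
have nk i : i < size h -> nth 0 k i = nth 0 h i - (size h - i.+1).
  by move=> lti; rewrite nth_mkseq.
have pk : all (leq 1) k.
  apply/(all_nthP 0) => i; rewrite szk => lti.
  by rewrite nk // subn_gt0 big'.
split=> //.
  apply/(sortedP 0) => i; rewrite szk => lti /=.
  rewrite !nk ?(ltnW lti) //.
  have := step _ lti; have := big' _ lti; have := big' _ (ltnW lti).
  move: (nth 0 h i) (nth 0 h i.+1) => x y ltx lty ltyx.
  have e : size h - i.+1 = (size h - i.+2).+1 by rewrite -subSn // subSS.
  have lt : y - (size h - i.+2) < x - (size h - i.+2).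
    by rewrite ltn_sub2r // (ltn_trans lty).
  by rewrite e (subnS x) -ltnS (ltn_predK lt).
have szf : size (first_column_hooks k) = size h by rewrite size_map size_iota.
apply: (@eq_from_nth _ 0) => // i; rewrite szf => lti.
have -> : nth 0 (first_column_hooks k) i = hook k i 0.
  by rewrite (nth_map 0) ?size_iota ?szk // nth_iota // szk.
rewrite /hook subn0 nk // (_ : count _ _ = size h - i.+1).
  by rewrite subnK // ltnW ?big'.
rewrite -szk -size_drop; apply/eqP; rewrite -all_count.
by apply/allP=> x /mem_drop /(allP pk).
Qed.

Definition m_row (m : nat) (kappa : seq nat) (i : nat) : bool :=
  all (fun h => (h == hook kappa i 0 %[mod m]) ==> (h <= hook kappa i 0))
      (first_column_hooks kappa).

Definition m_rows (m : nat) (kappa : seq nat) : seq nat :=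
  [seq i <- iota 0 (size kappa) | m_row m kappa i].

Definition m_boundary_boxes (m : nat) (kappa : seq nat) (i : nat) : nat :=
  count (fun j => hook kappa i j < m) (iota 0 (nth 0 kappa i)).

(** * The core of a path *)

(* The unit box with southeast corner (x, y) lies southeast of [P] iff its
   northwest corner (x - 1, y + 1) is weakly southeast of a point of [P]. *)
Definition box_below (P : seq bool) (x y : nat) : bool :=
  has (fun k => (easts P k < x) && (y < norths P k)) (iota 0 (size P).+1).

(* Truncated subtraction is harmless: only the positive fillings are kept. *)
Definition positive_hooks (a b : nat) (P : seq bool) : seq nat :=
  undup [seq h <- [seq b * y - a * x |
                     y <- iota 0 a, x <- [seq x <- iota 1 b | box_below P x y]]
        | 0 < h].

Definition core (a b : nat) (P : seq bool) : seq nat :=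
  partition_of_hooks (positive_hooks a b P).

(** * The maps zeta and eta *)

(* Trailing zeros are left out of these two sequences. *)
Definition lambda (a b : nat) (P : seq bool) : seq nat :=
  let kappa := core a b P in
  sort geq [seq m_boundary_boxes b kappa i | i <- m_rows a kappa].

Definition mu (a b : nat) (P : seq bool) : seq nat :=
  let kappa := core a b P in
  sort geq [seq m_boundary_boxes a kappa i | i <- m_rows b kappa].

(* In English notation, the row of the grid between heights r and r + 1 holds
   the part of index a - 1 - r of [s] (counted from 0, and 0 past the end).  The
   path bounding [s] climbs this row at abscissa that part, that is, after
   r + s_(a - 1 - r) earlier steps. *)
Definition bounding_path (a b : nat) (s : seq nat) : seq bool :=
  mkseq (fun i => if i \in [seq r + nth 0 s (a - r.+1) | r <- iota 0 a]
                  then north else east) (a + b).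

Definition zeta (a b : nat) (P : seq bool) : seq bool :=
  bounding_path a b (lambda a b P).

Definition eta (a b : nat) (P : seq bool) : seq bool :=
  bounding_path a b (conjugate (mu a b P)).

Definition admissible (a b : nat) (Q R : seq bool) : Prop :=
  exists2 P, P \in dyck a b & (Q, R) = (zeta a b P, eta a b P).

(** * The map iota *)

(* Steps are labelled from 0 instead of from 1. *)

(* The column of step [l] if it is an east step, its row if it is a north step. *)
Definition step_line (w : seq bool) (l : nat) : nat :=
  count_mem (nth east w l) (take l w).

(* Rotating a path by 180 degrees reverses its word.  The step sought is unique
   when [Q] and [R] have equally many north and equally many east steps. *)
Definition gamma (Q R : seq bool) (l : nat) : nat :=
  let R' := rev R in
  find (fun l' => (nth east R' l' == nth east Q l)
                  && (step_line R' l' == step_line Q l))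
       (iota 0 (size R')).

Definition single_cycle (n : nat) (f : nat -> nat) : Prop :=
  exists s : 'S_n,
    (forall i : 'I_n, s i = f i :> nat) /\ porbits s = [set setT].

Definition sigma (a b : nat) (Q R : seq bool) : seq nat :=
  traject (gamma Q R) 0 (a + b).

Definition cyclic_descent (s : seq nat) (i : nat) : bool :=
  nth 0 s (i.+1 %% size s) < nth 0 s i.

Definition iota_map (a b : nat) (Q R : seq bool) : seq bool :=
  mkseq (fun i => if cyclic_descent (sigma a b Q R) i then east else north)
        (a + b).

(* Main.v *)
Require Import Defs.
From mathcomp Require Import all_boot all_fingroup.
From mathcomp Require Import zify.

(** Give the lattice point (x, y) the level [b * y - a * x].  Along a Dyck path
    of length [n = a + b] the level starts and ends at 0, rises by [b] at a north
    step and drops by [a] at an east step; as [a] and [b] are coprime, the points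
    of the path other than the last one have pairwise distinct levels
    ([level_inj]).  Zeta and eta are both sorting (sweep) maps for the levels:
    - [zeta P] lists the steps of [P] by increasing level of their starting
      point ([zeta_sweeps]);
    - [eta P] rotated by 180 degrees lists the steps of [P] by increasing level
      of their end point ([rev_eta_sweeps]).

    Granting this, label each point of the path by the rank of its level.  The
    points that start a step and those that end a step are the same ones, so they
    carry the same labels.  Two steps of the same kind are in the same order
    whether they are compared by start or by end, since start and end differ by a
    constant; hence the [k]-th east (north) step of [zeta P] and that of
    the rotated [eta P] come from the same step of [P], and gamma sends the label
    of the start of each step to the label of its end ([gamma_pos]).  Thus gamma
    follows the path: it is a single cycle, its cycle notation from the least
    label lists the ranks of the levels along [P], and a cyclic descent is a drop
    in level, that is, an east step ([iota_map_zeta_eta]).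

    The sorting description of zeta and eta is read off the core.  The rows of
    the partition with set [H] of first-column hook lengths are described by the
    classical bijection: the hook lengths of the row with first hook [x] are the
    [x - g] with [g < x] not in [H] ([hook_lengths_row]).  When [H] is the set of
    positive hooks of [P], it consists of the positive numbers [s - t * a] with
    [s] the start of a north step and [t] positive, and as well of the positive
    [e - t * b] with [e] the end of an east step.  So the [a]-rows correspond to
    the starts [s] of north steps, with first hook [s - a], and the [b]-boundary
    boxes of such a row correspond to the east steps with end below [s - a], or
    equivalently with start below [s] ([count_boundary_parts]).  Hence the parts
    of lambda count, for each north step, the east steps that start lower, and
    exchanging the roles of [a] and [b], the parts of mu count, for each east
    step, the north steps that end lower.

    Finally, a word sorted by level is a Dyck path because the truncated level
    [min (level, t)] returns to its initial value along [P], gains at most [b] at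
    a north step starting below [t], loses exactly [a] at an east step starting
    below [t], and never increases at the other steps ([zeta_dyck]); eta is
    handled by [max (level, t)]. *)

Set Implicit Arguments.
Unset Strict Implicit.
Unset Printing Implicit Defensive.

(** * Parts of a partition *)

Lemma geq_trans : transitive geq.
Proof. by move=> x y z le1 le2; apply: leq_trans le2 le1. Qed.

(** This determines the parts of a partition from counts alone, so zero parts and
    the order in which the parts were produced become immaterial. *)
Lemma nth_geq_sorted (s : seq nat) (k j : nat) :
  sorted geq s -> (j < nth 0 s k) = (k < count (fun p => j < p) s).
Proof.
elim: s k => [|x s IHs] [|k] //= pxs; last first.
  rewrite IHs ?(path_sorted pxs) //.
  case: (ltnP j x) => [_|lexj]; first by rewrite add1n ltnS.
  rewrite add0n; have -> : count (fun p => j < p) s = 0; last by lia.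
  apply/eqP; rewrite -leqn0 leqNgt -has_count; apply/hasPn => p ps.
  have /allP/(_ p ps) /= := order_path_min geq_trans pxs.
  lia.
case: (ltnP j x) => [_|lexj]; first by rewrite add1n.
rewrite add0n -has_count; apply/esym/negbTE/hasPn => p ps.
have /allP/(_ p ps) /= := order_path_min geq_trans pxs.
lia.
Qed.

Lemma sort_geq_sorted (s : seq nat) : sorted geq (sort geq s).
Proof. by apply: sort_sorted => x y; rewrite /= leq_total. Qed.

Lemma nth_conjugate (s : seq nat) (j : nat) :
  nth 0 (Defs.conjugate s) j = count (fun p => j < p) s.
Proof.
rewrite /Defs.conjugate; case: (ltnP j (\max_(p <- s) p)) => [lt|le].
  by rewrite nth_mkseq.
rewrite nth_default ?size_mkseq //; apply/esym/eqP.
rewrite -leqn0 leqNgt -has_count; apply/hasPn => p ps.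
by rewrite -leqNgt (leq_trans _ le) // leq_bigmax_seq.
Qed.

(** * Rows of a partition with given first-column hook lengths *)

Section BetaSet.
Variable H : seq nat.
Hypotheses (uH : uniq H) (pH : all (leq 1) H).
Local Notation kappa := (partition_of_hooks H).
Local Notation h := (sort geq H).
Local Notation k := (size H).

Lemma size_partition_of_hooks : size kappa = k.
Proof. by rewrite /partition_of_hooks size_mkseq size_sort. Qed.

Lemma nth_partition_of_hooks i : i < k -> nth 0 kappa i + (k - i.+1) = nth 0 h i.
Proof.
move=> ltik; have [_ pk e] := partition_of_hooksP uH pH.
rewrite -e /first_column_hooks.
rewrite (nth_map 0) ?size_iota ?size_partition_of_hooks //.
rewrite nth_iota ?size_partition_of_hooks //.
rewrite /hook add0n subn0; congr (_ + _).
rewrite -size_partition_of_hooks -size_drop; apply/esym/eqP; rewrite -all_count.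
by apply/allP=> x /mem_drop /(allP pk).
Qed.

Lemma nth_hooks_decr i j : i < j < k -> nth 0 h j < nth 0 h i.
Proof.
move=> /andP[ltij ltjk].
have szh : size h = k by rewrite size_sort.
rewrite ltn_neqAle nth_uniq ?szh ?sort_uniq //; last by lia.
apply/andP; split; first by lia.
by apply: (sorted_ltn_nth geq_trans 0 (sort_geq_sorted H)); rewrite ?inE ?szh //; lia.
Qed.

Lemma partition_decr i j : i <= j -> nth 0 kappa j <= nth 0 kappa i.
Proof.
move=> leij; have [sk _ _] := partition_of_hooksP uH pH.
have rf : reflexive geq by move=> x; apply: leqnn.
case: (ltnP j k) => [ltjk|lekj]; last first.
  by rewrite [X in X <= _]nth_default // size_partition_of_hooks.
apply: (sorted_leq_nth geq_trans rf 0 sk) => //.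
  by rewrite inE size_partition_of_hooks (leq_ltn_trans leij).
by rewrite inE size_partition_of_hooks.
Qed.

Lemma legE i j : i < k ->
  count (fun p => j < p) (drop i.+1 kappa) =
    count (fun p => j < nth 0 kappa p) (iota i.+1 (k - i.+1)).
Proof.
move=> ltik; rewrite -[RHS](count_map (nth 0 kappa) (fun p => j < p)).
congr count; rewrite -[in LHS](mkseq_nth 0 kappa) /mkseq size_partition_of_hooks.
by rewrite -map_drop drop_iota ?add0n ?addn0.
Qed.

(** Parts are nonincreasing, so the rows that reach past column [j] form an initial
    segment of the rows.  Whether row [p] reaches past it or not therefore bounds
    the leg of a box in column [j] from below or from above. *)
Lemma leg_gt i j p : i < p < k -> j < nth 0 kappa p ->
  p - i <= count (fun p => j < p) (drop i.+1 kappa).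
Proof.
move=> lt ltj; rewrite legE; last by lia.
have -> : k - i.+1 = (p - i) + (k - p.+1) by lia.
rewrite iotaD count_cat.
apply: leq_trans (leq_addr _ _).
rewrite -{1}[p - i](size_iota i.+1) -{1}(@count_predT _ (iota _ _)).
rewrite (@eq_in_count _ predT (fun p => j < nth 0 kappa p)) // => q.
rewrite mem_iota => hq.
by rewrite (leq_trans ltj) // partition_decr //; lia.
Qed.

Lemma leg_le i j p : i < p < k -> nth 0 kappa p <= j ->
  count (fun p => j < p) (drop i.+1 kappa) <= p - i.+1.
Proof.
move=> lt ltj; rewrite legE; last by lia.
have -> : k - i.+1 = (p - i.+1) + (k - p) by lia.
rewrite iotaD count_cat.
have -> : count (fun p => j < nth 0 kappa p) (iota (i.+1 + (p - i.+1)) (k - p)) = 0.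
  apply/eqP; rewrite -leqn0 leqNgt -has_count; apply/hasPn => q.
  rewrite mem_iota -leqNgt => hq; apply: leq_trans ltj; apply: partition_decr; lia.
by rewrite addn0 (leq_trans (count_size _ _)) // size_iota.
Qed.

Lemma leg_antimono i j j' : j <= j' ->
  count (fun p => j' < p) (drop i.+1 kappa) <= count (fun p => j < p) (drop i.+1 kappa).
Proof. by move=> le; apply: sub_count => p /=; lia. Qed.

Lemma leg_size i j : i < k -> count (fun p => j < p) (drop i.+1 kappa) <= k - i.+1.
Proof.
move=> lt; rewrite (leq_trans (count_size _ _)) // size_drop.
by rewrite size_partition_of_hooks.
Qed.

(** The complement to [x], the first hook of the row, of the hook in column [j] is
    [j] plus the number of lower rows that do not reach past column [j].  This is
    strictly increasing in [j], and it avoids [H]: the two bounds on the leg place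
    it strictly below or strictly above the first hook of any lower row [p].  As
    there are as many columns as nonmembers of [H] below [x], all are hit. *)
Lemma hook_lengths_row i : i < k ->
  perm_eq [seq nth 0 h i - hook kappa i j | j <- iota 0 (nth 0 kappa i)]
          [seq g <- iota 0 (nth 0 h i) | g \notin H].
Proof.
move=> ltik; have eh := nth_partition_of_hooks ltik.
have hb j : j < nth 0 kappa i -> 0 < hook kappa i j <= nth 0 h i.
  by move=> ltj; have := leg_size j ltik; rewrite /hook; lia.
have inj : {in iota 0 (nth 0 kappa i) &, injective (fun j => nth 0 h i - hook kappa i j)}.
  move=> j j'; rewrite !mem_iota /= !add0n => lj lj'.
  have := hb _ lj; have := hb _ lj'; rewrite /hook.
  case: (leqP j j') => lejj'; first by have := leg_antimono i lejj'; lia.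
  by have := leg_antimono i (ltnW lejj'); lia.
have nonmem j : j < nth 0 kappa i -> nth 0 h i - hook kappa i j \notin H.
  move=> ltj; apply/negP => gH; have := hb _ ltj; move: gH.
  rewrite -(mem_sort geq) => /(nthP 0) [p]; rewrite size_sort => ltpk0 ep0 hbj.
  have ltpk : p < k := ltpk0.
  have ep : nth 0 h p = nth 0 h i - hook kappa i j := ep0.
  have ltip : i < p.
    rewrite ltnNge; apply/negP => lepi.
    have [epi|nepi] := eqVneq p i; first by move: ep hbj; rewrite epi; lia.
    have := @nth_hooks_decr p i; rewrite ltik ltn_neqAle nepi lepi; move: ep hbj; lia.
  have ehp := nth_partition_of_hooks ltpk.
  case: (ltnP j (nth 0 kappa p)) => [lt|le].
    have := @leg_gt i j p; rewrite ltip ltpk /= => /(_ isT lt).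
    by move: ep hbj; rewrite /hook; lia.
  have := @leg_le i j p; rewrite ltip ltpk /= => /(_ isT le).
  by move: ep hbj; rewrite /hook; lia.
apply: uniq_perm; [|by rewrite filter_uniq ?iota_uniq|].
  by rewrite map_inj_in_uniq ?iota_uniq.
(* The [k - i.+1] lower rows have their first hooks below [nth 0 h i], which
   leaves at most [nth 0 kappa i] nonmembers of [H]. *)
have [] // := @uniq_min_size _
  [seq nth 0 h i - hook kappa i j | j <- iota 0 (nth 0 kappa i)]
  [seq g <- iota 0 (nth 0 h i) | g \notin H].
- by rewrite map_inj_in_uniq ?iota_uniq.
- move=> g /mapP[j]; rewrite mem_iota /= add0n => ltj ->.
  by rewrite mem_filter nonmem //= mem_iota; have := hb _ ltj; lia.
rewrite size_map size_iota size_filter.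
have e := count_predC (mem H) (iota 0 (nth 0 h i)).
rewrite size_iota in e.
suff : k - i.+1 <= count (mem H) (iota 0 (nth 0 h i)).
  by move: e; rewrite [X in _ + X = _](@eq_count _ _ (fun g => g \notin H)) //; lia.
rewrite -size_filter.
have -> : k - i.+1 = size (drop i.+1 h) by rewrite size_drop size_sort.
apply: uniq_leq_size; first by rewrite drop_uniq // sort_uniq.
move=> g /(nthP 0) [q]; rewrite size_drop size_sort nth_drop => ltq0 <-.
have ltq : q < k - i.+1 := ltq0.
rewrite mem_filter mem_iota /= -(mem_sort geq) mem_nth ?size_sort //; last by lia.
by apply: nth_hooks_decr; lia.
Qed.

Lemma m_boundary_boxesE m i : i < k ->
  m_boundary_boxes m kappa i =
    count (fun g => (g \notin H) && (nth 0 h i < g + m)) (iota 0 (nth 0 h i)).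
Proof.
move=> ltik; rewrite /m_boundary_boxes.
transitivity (count (fun g => nth 0 h i < g + m)
    [seq nth 0 h i - hook kappa i j | j <- iota 0 (nth 0 kappa i)]).
  rewrite count_map; apply: eq_in_count => j; rewrite mem_iota /= add0n => ltj.
  have := nth_partition_of_hooks ltik; have := leg_size j ltik.
  by rewrite /hook; lia.
rewrite (seq.permP (hook_lengths_row ltik)) count_filter; apply: eq_count => g /=.
by rewrite andbC.
Qed.

Lemma m_boundary_rowsE m m' :
  perm_eq [seq m_boundary_boxes m' kappa i | i <- m_rows m kappa]
    [seq count (fun g => (g \notin H) && (x < g + m')) (iota 0 x) |
       x <- H & all (fun y => (y == x %[mod m]) ==> (y <= x)) H].
Proof.
have [_ _ e] := partition_of_hooksP uH pH.
set F := fun x => count _ _; set M := fun x => all _ _.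
rewrite /m_rows size_partition_of_hooks.
have -> : [seq m_boundary_boxes m' kappa i | i <- iota 0 k & m_row m kappa i]
        = [seq F x | x <- h & M x].
  rewrite -e /first_column_hooks size_partition_of_hooks filter_map -map_comp.
  have eM i : i \in iota 0 k -> m_row m kappa i = preim (fun i => hook kappa i 0) M i.
    by rewrite mem_iota /= => ltik; rewrite /m_row e all_sort.
  rewrite (eq_in_filter eM); apply/eq_in_map => i; rewrite mem_filter mem_iota /= add0n.
  case/andP=> _ ltik; rewrite m_boundary_boxesE //.
  suff -> : hook kappa i 0 = nth 0 h i by [].
  rewrite -e (nth_map 0) ?size_iota ?size_partition_of_hooks //.
  by rewrite nth_iota ?size_partition_of_hooks.
apply: perm_map; apply: perm_filter; apply: permEl; exact: perm_sort.
Qed.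

End BetaSet.

(** * Boundary boxes from two systems of residues *)

(** Elements of [S] in distinct classes modulo [m] are the thresholds from which
    their classes leave [H]. *)
Definition strictly_below_residues (m : nat) (S H : seq nat) : Prop :=
  forall h, h \in H <->
    0 < h /\ exists2 s, s \in S & exists2 t, 0 < t & h + t * m = s.

Lemma uniq_modn_eq (m : nat) (T : seq nat) (x y : nat) :
    uniq [seq e %% m | e <- T] -> x \in T -> y \in T -> x = y %[mod m] ->
  x = y.
Proof.
elim: T => //= e T IHT /andP[eT uT]; rewrite !inE.
case/predU1P=> [->|xT] /predU1P[->|yT] // exy.
- by case/negP: eT; rewrite exy; apply: map_f.
- by case/negP: eT; rewrite -exy; apply: map_f.
- exact: IHT.
Qed.

Lemma complete_residues (m : nat) (T : seq nat) (g : nat) :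
    0 < m -> uniq [seq e %% m | e <- T] -> size T = m ->
  exists2 e, e \in T & e = g %[mod m].
Proof.
move=> m0 uT sT.
have [||_ eqT] := @uniq_min_size _ [seq e %% m | e <- T] (iota 0 m) uT.
- by move=> _ /mapP[e _ ->]; rewrite mem_iota /= ltn_pmod.
- by rewrite size_map size_iota sT.
have : g %% m \in [seq e %% m | e <- T] by rewrite eqT mem_iota /= ltn_pmod.
by case/mapP=> e eT ->; exists e.
Qed.

(** The element of [T] in the class of [g] is the threshold between members and
    nonmembers of [H].  The hypothesis [0 \in T] takes care of [g = 0], which is
    outside [H] without being positive. *)
Lemma notin_hooks (m : nat) (T H : seq nat) (g : nat) :
    0 < m -> uniq [seq e %% m | e <- T] -> size T = m -> 0 \in T ->
    strictly_below_residues m T H ->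
  reflect (exists2 e, e \in T & e <= g /\ e = g %[mod m]) (g \notin H).
Proof.
move=> m0 uT sT T0 HT; apply: (iffP idP) => [gH|[e eT [leeg egm]]].
  have [e eT eg] := complete_residues g m0 uT sT.
  exists e => //; split=> //; rewrite leqNgt; apply/negP => lt.
  case/negP: gH; apply/HT.
  have g0 : 0 < g.
    rewrite lt0n; apply/eqP => g0; rewrite g0 in eg lt.
    by rewrite (uniq_modn_eq uT eT T0 eg) in lt.
  split=> //; exists e => //.
  have dv : m %| e - g by rewrite -eqn_mod_dvd ?(ltnW lt) //; apply/eqP.
  exists ((e - g) %/ m); first by rewrite divn_gt0 // dvdn_leq // subn_gt0.
  by rewrite divnK // subnKC // ltnW.
apply/negP => /HT[g0 [e' e'T [t t0 et]]].
have ee : e = e' by apply: (uniq_modn_eq uT) => //; rewrite -et addnC modnMDl.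
have : 0 < t * m by rewrite muln_gt0 t0 m0.
by move: leeg; rewrite ee -et; lia.
Qed.

(** Each residue class modulo [b] meets the window of integers from [h - b + 1] to
    [h - 1] at most once, the class of [h] not at all.  The representative of a
    class is a nonmember of [H] exactly when it is at least the threshold [e] of the
    class, that is, when [e < h]. *)
Lemma count_boundary_window (b h : nat) (T H : seq nat) :
    0 < b -> uniq [seq e %% b | e <- T] -> size T = b -> 0 \in T ->
    strictly_below_residues b T H -> h \in H ->
  count (fun g => (g \notin H) && (h < g + b)) (iota 0 h) =
    count (fun e => e < h) T.
Proof.
move=> b0 uT sT T0 HT hH.
have nH := notin_hooks _ b0 uT sT T0 HT.
(* [phi e] is the largest number below [h] that is congruent to [e]. *)
pose phi e := h.-1 - (h.-1 - e) %% b.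
have h0 : 0 < h by case/HT: hH.
have phiE e : e < h -> [/\ e <= phi e, phi e < h, h <= phi e + b & phi e = e %[mod b]].
  move=> lt; have := ltn_pmod (h.-1 - e) b0; have := leq_mod (h.-1 - e) b.
  have dE := divn_eq (h.-1 - e) b; rewrite /phi.
  split; [lia|lia|lia|].
  have -> : h.-1 - (h.-1 - e) %% b = (h.-1 - e) %/ b * b + e by lia.
  by rewrite modnMDl.
rewrite -!size_filter.
suff : perm_eq [seq phi e | e <- T & e < h]
    [seq g <- iota 0 h | (g \notin H) && (h < g + b)].
  by move/perm_size; rewrite size_map.
have uT' : uniq T by apply: map_uniq uT.
apply: uniq_perm; last 1 first.
- move=> g; rewrite mem_filter mem_iota /= add0n; apply/mapP/idP => [[e]|].
    rewrite mem_filter => /andP[lt eT] ->.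
    have [le1 lt2 le3 em] := phiE _ lt.
    rewrite lt2 andbT; apply/andP; split.
      by apply/nH; exists e.
    rewrite ltn_neqAle le3 andbT; apply/eqP => eh.
    have /negP[] // : h \notin H.
    apply/nH; exists e => //; split; first exact: ltnW.
    by rewrite [in RHS]eh modnDr em.
  case/andP=> /andP[/nH[e eT [le em]] lt] ltg.
  have lte : e < h by lia.
  exists e; first by rewrite mem_filter lte.
  have [le1 lt2 le3 em'] := phiE _ lte.
  have dd : b %| g - e by rewrite -eqn_mod_dvd //; apply/eqP.
  have dd' : b %| phi e - e by rewrite -eqn_mod_dvd //; apply/eqP.
  case/dvdnP: dd => x ex; case/dvdnP: dd' => y ey.
  suff : x = y by lia.
  nia.
- rewrite map_inj_in_uniq ?filter_uniq // => e e'.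
  rewrite !mem_filter => /andP[lt eT] /andP[lt' e'T] ee.
  apply: (uniq_modn_eq uT) => //.
  by have [_ _ _ <-] := phiE _ lt; have [_ _ _ <-] := phiE _ lt'; rewrite ee.
- by rewrite filter_uniq ?iota_uniq.
Qed.

(** The largest member of [H] in the class of [s] is [s - a], if this is
    positive. *)
Lemma maximal_hooks (a : nat) (S H : seq nat) :
    0 < a -> uniq [seq s %% a | s <- S] -> strictly_below_residues a S H ->
    uniq H ->
  perm_eq [seq x <- H | all (fun y => (y == x %[mod a]) ==> (y <= x)) H]
          [seq s - a | s <- S & a < s].
Proof.
move=> a0 uS HS uH.
have uS' : uniq S by apply: map_uniq uS.
apply: uniq_perm; first by rewrite filter_uniq.
  rewrite map_inj_in_uniq ?filter_uniq // => s s'.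
  by rewrite !mem_filter; lia.
move=> x; rewrite mem_filter; apply/andP/mapP => [[/allP max xH]|[s]].
  have /HS [x0 [s sS [t t0 e]]] := xH.
  have lea : a <= t * a by rewrite leq_pmull.
  exists s; first by rewrite mem_filter sS andbT; lia.
  have sH : s - a \in H.
    by apply/HS; split; [lia | exists s => //; exists 1 => //; lia].
  have := max _ sH.
  have -> : s - a == x %[mod a].
    have -> : s - a = t.-1 * a + x by nia.
    by rewrite modnMDl.
  by move=> /=; lia.
rewrite mem_filter => /andP[lt sS] ->; split; last first.
  by apply/HS; split; [lia | exists s => //; exists 1 => //; lia].
apply/allP => y /HS[y0 [s' s'S [t t0 e]]]; apply/implyP => /eqP em.
suff es : s' = s.
  have : a <= t * a by rewrite leq_pmull.
  by lia.
apply: (uniq_modn_eq uS) => //.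
have -> : s = 1 * a + (s - a) by lia.
by rewrite -e addnC !modnMDl em.
Qed.

(** Symmetric in the two systems, so that it serves both for lambda and, with the
    roles of [a] and [b] exchanged, for mu. *)
Lemma count_boundary_parts (a b : nat) (S T H : seq nat) (j : nat) :
    0 < a -> 0 < b -> uniq H ->
    uniq [seq s %% a | s <- S] -> strictly_below_residues a S H ->
    uniq [seq e %% b | e <- T] -> size T = b -> 0 \in T ->
    strictly_below_residues b T H ->
  count (fun p => j < p)
    [seq m_boundary_boxes b (partition_of_hooks H) i |
       i <- m_rows a (partition_of_hooks H)] =
  count (fun s => j < count (fun e => e + a < s) T) S.
Proof.
move=> a0 b0 uH uS HS uT sT T0 HT.
have pH : all (leq 1) H by apply/allP => x /HS[].
rewrite (seq.permP (m_boundary_rowsE uH pH _ _)).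
transitivity (count (fun p => j < p) [seq count (fun e => e < x) T |
   x <- H & all (fun y => (y == x %[mod a]) ==> (y <= x)) H]).
  congr count; apply/eq_in_map => x; rewrite mem_filter => /andP[_ xH].
  exact: count_boundary_window.
rewrite (seq.permP (perm_map _ (maximal_hooks a0 uS HS uH))).
rewrite -map_comp count_map count_filter; apply: eq_count => s /=.
case: (ltnP a s) => [lt|le].
  by rewrite andbT; congr (_ < _); apply: eq_count => e; lia.
(* A start [s <= a] gives no row of the core, and no end [e] counts for it. *)
rewrite andbF; have -> : count (fun e => e + a < s) T = 0; last by [].
by apply/eqP; rewrite -leqn0 leqNgt -has_count; apply/hasPn => e _; lia.
Qed.

(** * Steps and levels of a Dyck path *)

Lemma count_takeS (c : bool) (w : seq bool) (k : nat) : k < size w ->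
  count_mem c (take k.+1 w) = count_mem c (take k w) + (nth east w k == c).
Proof. by move=> lt; rewrite (take_nth east) // -cats1 count_cat /= addn0. Qed.

Lemma leq_count_take (c : bool) (w : seq bool) (i j : nat) : i <= j ->
  count_mem c (take i w) <= count_mem c (take j w).
Proof.
move=> le; have e : j = i + (j - i) by lia.
by rewrite e takeD count_cat leq_addr.
Qed.

Lemma exists_step (c : bool) (w : seq bool) (k j : nat) :
    k <= size w -> j < count_mem c (take k w) ->
  exists2 m, m < k & nth east w m = c /\ count_mem c (take m w) = j.
Proof.
elim: k => [|k IHk] ltk; first by rewrite take0.
rewrite count_takeS //; case: (ltnP j (count_mem c (take k w))) => [lt _|le].
  by have [m ltm []] := IHk (ltnW ltk) lt; exists m; first exact: ltnW.
case: eqP => [e|_] lt; last by lia.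
by exists k => //; split=> //; lia.
Qed.

Lemma step_line_inj (w : seq bool) (l l' : nat) :
    l < size w -> l' < size w -> nth east w l = nth east w l' ->
    step_line w l = step_line w l' ->
  l = l'.
Proof.
have gt i j : i < j -> j < size w -> nth east w i = nth east w j ->
    step_line w i < step_line w j.
  move=> lt ltj e; rewrite /step_line e.
  apply: leq_trans (leq_count_take _ _ lt).
  by rewrite count_takeS ?(ltn_trans lt) // e eqxx addn1.
move=> ltl ltl' e es; case: (ltngtP l l') => // lt.
- by have := gt _ _ lt ltl' e; rewrite es ltnn.
- by have := gt _ _ lt ltl (esym e); rewrite es ltnn.
Qed.

(** Truncation never occurs on a Dyck path. *)
Definition level (a b : nat) (w : seq bool) (k : nat) : nat :=
  b * norths w k - a * easts w k.

Section Levels.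
Variables (a b : nat) (w : seq bool).
Hypothesis (wD : w \in dyck a b).
Local Notation n := (a + b).
Local Notation L := (level a b w).
Local Notation step := (nth east w).

Lemma dyck_count_east : count_mem east w = b.
Proof. by case/and3P: wD => /eqP. Qed.

Lemma dyck_count_north : count_mem north w = a.
Proof. by case/and3P: wD => _ /eqP. Qed.

Lemma size_dyck : size w = n.
Proof.
rewrite -dyck_count_east -dyck_count_north addnC.
rewrite -(count_predC (pred1 east)); congr (_ + _).
by apply: eq_count; case.
Qed.

Lemma norths_easts k : k <= n -> norths w k + easts w k = k.
Proof.
move=> le; rewrite /norths /easts addnC -[RHS](@size_takel k _ w) ?size_dyck //.
rewrite -[RHS](count_predC (pred1 east)); congr (_ + _).
by apply: eq_count; case.
Qed.

Lemma leq_dyck k : k <= n -> a * easts w k <= b * norths w k.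
Proof.
move=> le; case/and3P: wD => _ _ /allP/(_ k); apply.
by rewrite mem_iota size_dyck.
Qed.

Lemma norths_le k : norths w k <= a.
Proof.
by rewrite -dyck_count_north -[X in _ <= count _ X](cat_take_drop k w) count_cat leq_addr.
Qed.

Lemma easts_le k : easts w k <= b.
Proof.
by rewrite -dyck_count_east -[X in _ <= count _ X](cat_take_drop k w) count_cat leq_addr.
Qed.

Lemma north_next k : k < n -> step k = north ->
  norths w k.+1 = (norths w k).+1 /\ easts w k.+1 = easts w k.
Proof.
by move=> lt e; rewrite /norths /easts !count_takeS ?size_dyck // e addn1 addn0.
Qed.

Lemma east_next k : k < n -> step k = east ->
  norths w k.+1 = norths w k /\ easts w k.+1 = (easts w k).+1.
Proof.
by move=> lt e; rewrite /norths /easts !count_takeS ?size_dyck // e addn1 addn0.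
Qed.

Lemma level_north k : k < n -> step k = north -> L k.+1 = L k + b.
Proof.
move=> lt e; have [eN eE] := north_next lt e.
by have := leq_dyck (ltnW lt); rewrite /level eN eE mulnS; lia.
Qed.

Lemma level_east k : k < n -> step k = east -> L k = L k.+1 + a.
Proof.
move=> lt e; have [eN eE] := east_next lt e.
by have := leq_dyck lt; rewrite /level eN eE mulnS; lia.
Qed.

Lemma level0 : L 0 = 0.
Proof. by rewrite /level /norths take0 muln0. Qed.

Lemma level_last : L n = 0.
Proof.
rewrite /level /norths /easts -size_dyck take_size.
by rewrite dyck_count_east dyck_count_north mulnC subnn.
Qed.

Hypotheses (ha : 0 < a) (hb : 0 < b) (hab : coprime a b).

(** Equal levels at two points force the horizontal and vertical displacements
    between them to be proportional to [b] and [a]; by coprimality they are either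
    both zero or those of the whole path. *)
Lemma level_inj i j : i < n -> j < n -> L i = L j -> i = j.
Proof.
wlog leij : i j / i <= j.
  by move=> W li lj e; case: (leqP i j) => [|/ltnW] le; [|symmetry]; apply: W.
move=> li lj; have := leq_dyck (ltnW li); have := leq_dyck (ltnW lj).
have := norths_easts (ltnW li); have := norths_easts (ltnW lj).
have := norths_le j; have := easts_le j.
have := @leq_count_take north w _ _ leij.
have := @leq_count_take east w _ _ leij.
rewrite -!/(norths _ _) -!/(easts _ _) /level.
move: (norths w i) (norths w j) (easts w i) (easts w j).
move=> x y x' y' l1 l2 l3 l4 e1 e2 d1 d2 e.
have E : b * (y - x) = a * (y' - x') by rewrite !mulnBr; lia.
have dv : a %| y - x.
  by rewrite -(Gauss_dvdr _ hab) E dvdn_mulr.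
case/dvdnP: dv => q eq.
have q1 : q <= 1 by nia.
case: q q1 eq => [|[|//]] _ eq.
  suff : y' - x' = 0 by lia.
  by apply/eqP; have := E; rewrite eq muln0 => /esym/eqP; rewrite muln_eq0; lia.
have : y' - x' = b.
  by apply/eqP; rewrite -(eqn_pmul2l ha) -E eq mul1n mulnC.
by lia.
Qed.

Definition steps_of (c : bool) : seq nat := [seq m <- iota 0 n | step m == c].

Lemma mem_steps_of c m : m \in steps_of c = (step m == c) && (m < n).
Proof. by rewrite mem_filter mem_iota. Qed.

Lemma size_steps_of c : size (steps_of c) = count_mem c w.
Proof.
rewrite size_filter -[in RHS](mkseq_nth east w) /mkseq count_map size_dyck.
by apply: eq_count.
Qed.

Definition starts (c : bool) : seq nat := [seq L m | m <- steps_of c].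
Definition ends (c : bool) : seq nat := [seq L m.+1 | m <- steps_of c].

(** Modulo [a] the level of a point is [b] times its height, so coprimality
    separates the north steps, whose heights are distinct and below [a]. *)
Lemma north_starts_residues : uniq [seq s %% a | s <- starts north].
Proof.
rewrite -map_comp map_inj_in_uniq ?filter_uniq ?iota_uniq // => i j.
rewrite !mem_steps_of => /andP[/eqP ei li] /andP[/eqP ej lj] /= e.
wlog leij : i j ei li ej lj e / i <= j.
  by move=> W; case: (leqP i j) => [|/ltnW] le; [|symmetry]; apply: W.
apply: (step_line_inj (w := w)); rewrite ?size_dyck // ?ei ?ej //.
rewrite /step_line ei ej -!/(norths _ _).
have l1 : norths w i <= norths w j by apply: leq_count_take.
have l2 : easts w i <= easts w j by apply: leq_count_take.
have l3 : norths w j < a by have [<- _] := north_next lj ej; apply: norths_le.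
have h1 := leq_dyck (ltnW li); have h2 := leq_dyck (ltnW lj).
have : b * norths w i = b * norths w j %[mod a].
  have -> : b * norths w i = easts w i * a + L i by rewrite /level; lia.
  have -> : b * norths w j = easts w j * a + L j by rewrite /level; lia.
  by rewrite !modnMDl.
move/esym/eqP; rewrite eqn_mod_dvd ?leq_mul2l ?l1 ?orbT // -mulnBr Gauss_dvdr //.
move=> dv; apply/eqP; rewrite eqn_leq l1 -subn_eq0 /=.
by apply: contraTT dv => nz; rewrite gtnNdvd // ?lt0n //; lia.
Qed.

Lemma east_ends_residues : uniq [seq e %% b | e <- ends east].
Proof.
rewrite -map_comp map_inj_in_uniq ?filter_uniq ?iota_uniq // => i j.
rewrite !mem_steps_of => /andP[/eqP ei li] /andP[/eqP ej lj] /= e.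
wlog leij : i j ei li ej lj e / i <= j.
  by move=> W; case: (leqP i j) => [|/ltnW] le; [|symmetry]; apply: W.
apply: (step_line_inj (w := w)); rewrite ?size_dyck // ?ei ?ej //.
rewrite /step_line ei ej -!/(easts _ _).
have l2 : easts w i <= easts w j by apply: leq_count_take.
have l3 : easts w j < b by have [_ <-] := east_next lj ej; apply: easts_le.
have h1 := leq_dyck li; have h2 := leq_dyck lj.
have [_ e1] := east_next li ei; have [_ e2] := east_next lj ej.
have : a * easts w i.+1 = a * easts w j.+1 %[mod b].
  apply/eqP; rewrite -(eqn_modDr (L i.+1)).
  rewrite -[in X in _ == X]modnDmr e modnDmr.
  have -> : a * easts w i.+1 + L i.+1 = norths w i.+1 * b by rewrite /level; lia.
  have -> : a * easts w j.+1 + L j.+1 = norths w j.+1 * b by rewrite /level; lia.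
  by rewrite !modnMl.
rewrite e1 e2.
move/esym/eqP; rewrite eqn_mod_dvd ?leq_mul2l ?ltnS ?l2 ?orbT //.
rewrite -mulnBr Gauss_dvdr 1?coprime_sym // subSS => dv.
apply/eqP; rewrite eqn_leq l2 -subn_eq0 /=.
by apply: contraTT dv => nz; rewrite gtnNdvd // ?lt0n //; lia.
Qed.

Lemma zero_north_starts : 0 \in starts north.
Proof.
have n0 : 0 < n by lia.
apply/mapP; exists 0; last by rewrite level0.
rewrite mem_steps_of n0 andbT.
case e: (step 0) => //.
by have := level_east n0 e; rewrite level0; lia.
Qed.

Lemma zero_east_ends : 0 \in ends east.
Proof.
have n0 : n.-1 < n by lia.
have en : n.-1.+1 = n by lia.
apply/mapP; exists n.-1; last by rewrite en level_last.
rewrite mem_steps_of n0 andbT.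
case e: (step n.-1) => //.
by have := level_north n0 e; rewrite en level_last; lia.
Qed.

Lemma mem_positive_hooks h : h \in positive_hooks a b w <->
  0 < h /\ exists x y, [/\ 0 < x <= b, y < a, box_below w x y & h + a * x = b * y].
Proof.
rewrite /positive_hooks mem_undup mem_filter; split.
  case/andP=> h0 /allpairsPdep[y [x []]].
  rewrite mem_filter !mem_iota => ly /andP[bx lx] e.
  by split=> //; exists x, y; split=> //; lia.
case=> h0 [x [y [lx ly bx e]]]; rewrite h0; apply/allpairsPdep; exists y, x.
by rewrite mem_filter bx !mem_iota; split; lia.
Qed.

Lemma box_belowP x y :
  reflect (exists2 k, k <= n & easts w k < x /\ y < norths w k) (box_below w x y).
Proof.
apply: (iffP hasP) => [[k]|[k lek [h1 h2]]].
  by rewrite mem_iota size_dyck ltnS => /= lek /andP[h1 h2]; exists k.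
by exists k; rewrite ?h1 ?h2 // mem_iota size_dyck ltnS.
Qed.

(** Moving a box one column to the right lowers its filling by [a]; the box just
    right of the north step in its row has the filling [L m - a]. *)
Lemma hooks_below_north_starts :
  strictly_below_residues a (starts north) (positive_hooks a b w).
Proof.
move=> h; rewrite mem_positive_hooks; split.
  case=> h0 [x [y [lx ly /box_belowP[k lek [h1 h2]] e]]]; split=> //.
  have [|m ltm [em cm]] := @exists_step north w k y _ h2; first by rewrite size_dyck.
  rewrite -/(norths w m) in cm.
  exists (L m); first by rewrite map_f // mem_steps_of em eqxx /=; lia.
  have le : easts w m <= easts w k by apply: leq_count_take; lia.
  have d := @leq_dyck m; rewrite /level cm.
  exists (x - easts w m); first by lia.
  have : a * easts w m <= a * x by rewrite leq_mul2l; lia.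
  by rewrite mulnBl [x * a]mulnC [easts w m * a]mulnC; lia.
case=> h0 [s /mapP[m]]; rewrite mem_steps_of => /andP[/eqP em ltm] -> [t t0 e].
split=> //; have [eN eE] := north_next ltm em.
have d := leq_dyck (ltnW ltm).
exists (easts w m + t), (norths w m).
have E : h + a * (easts w m + t) = b * norths w m.
  by rewrite mulnDr [a * t]mulnC; move: e; rewrite /level; lia.
have ly : norths w m < a by rewrite -eN norths_le.
split=> //; last by apply/box_belowP; exists m.+1; rewrite // eE eN; lia.
apply/andP; split; first by lia.
by rewrite -(leq_pmul2l ha); nia.
Qed.

(** Moving a box one row down lowers its filling by [b]; the box just below the
    east step in its column has the filling [L m.+1 - b]. *)
Lemma hooks_below_east_ends :
  strictly_below_residues b (ends east) (positive_hooks a b w).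
Proof.
move=> h; rewrite mem_positive_hooks; split.
  case=> h0 [x [y [lx ly /box_belowP[k lek [h1 h2]] e]]]; split=> //.
  have lx' : x.-1 < count_mem east (take n w).
    by rewrite -size_dyck take_size dyck_count_east; lia.
  have [|m ltm [em cm]] := @exists_step east w n x.-1 _ lx'; first by rewrite size_dyck.
  rewrite -/(easts w m) in cm.
  have lekm : k <= m.
    rewrite leqNgt; apply/negP => lt.
    have : easts w m.+1 <= easts w k by apply: leq_count_take.
    have [_ ->] := east_next ltm em.
    by lia.
  have [eN eE] := east_next ltm em.
  exists (L m.+1).
    by apply/mapP; exists m; rewrite // mem_steps_of em eqxx /=; lia.
  have le : norths w k <= norths w m by apply: leq_count_take; lia.
  have d := leq_dyck ltm.
  exists (norths w m - y); first by lia.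
  rewrite /level eN eE cm prednK; last by lia.
  have : b * y <= b * norths w m by rewrite leq_mul2l; lia.
  by rewrite mulnBl [y * b]mulnC [norths w m * b]mulnC; lia.
case=> h0 [s /mapP[m]]; rewrite mem_steps_of => /andP[/eqP em ltm] -> [t t0 e].
split=> //; have [eN eE] := east_next ltm em.
have d := leq_dyck ltm.
exists (easts w m.+1), (norths w m - t).
have lt : t < norths w m.
  by rewrite -(ltn_pmul2l hb); move: e; rewrite /level eN; lia.
split.
- by rewrite eE -eE easts_le eE.
- by have := norths_le m; lia.
- by apply/box_belowP; exists m; [lia|rewrite eE; lia].
have : b * t <= b * norths w m by rewrite leq_mul2l; lia.
by rewrite mulnBr [b * t]mulnC; move: e; rewrite /level eN; lia.
Qed.

Lemma uniq_positive_hooks : uniq (positive_hooks a b w).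
Proof. exact: undup_uniq. Qed.

(** An east step ending below [L m - a] is one that starts below [L m]. *)
Lemma count_lambda j :
  count (fun p => j < p) (lambda a b w) =
  count (fun m => j < count (fun e => L e < L m) (steps_of east)) (steps_of north).
Proof.
rewrite /lambda count_sort (count_boundary_parts _ ha hb uniq_positive_hooks
  north_starts_residues hooks_below_north_starts
  east_ends_residues _ zero_east_ends hooks_below_east_ends); last first.
  by rewrite size_map size_steps_of dyck_count_east.
rewrite count_map; apply: eq_count => m /=; rewrite count_map; congr (_ < _).
apply: eq_in_count => e; rewrite mem_steps_of => /andP[/eqP ee lte] /=.
by rewrite -level_east.
Qed.

Lemma count_mu j :
  count (fun p => j < p) (mu a b w) =
  count (fun m => j < count (fun e => L e.+1 < L m.+1) (steps_of north)) (steps_of east).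
Proof.
rewrite /mu count_sort (count_boundary_parts _ hb ha uniq_positive_hooks
  east_ends_residues hooks_below_east_ends
  north_starts_residues _ zero_north_starts hooks_below_north_starts); last first.
  by rewrite size_map size_steps_of dyck_count_north.
rewrite count_map; apply: eq_count => m /=; rewrite count_map; congr (_ < _).
apply: eq_in_count => e; rewrite mem_steps_of => /andP[/eqP ee lte] /=.
by rewrite -level_north.
Qed.

End Levels.

(** * Words sorted by a key *)

Definition rank (s : seq nat) (K : nat -> nat) (i : nat) : nat :=
  count (fun j => K j < K i) s.

Lemma sub_count_lt (P P' : pred nat) (s : seq nat) (i : nat) :
    subpred P P' -> i \in s -> ~~ P i -> P' i ->
  count P s < count P' s.
Proof.
move=> sub; elim: s => //= x s IHs; rewrite inE => /predU1P[<-|si] nP P'i.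
  by rewrite (negbTE nP) P'i add0n add1n ltnS sub_count.
by rewrite -addnS leq_add ?IHs //; case Px: (P x) => //; rewrite sub.
Qed.

Lemma rank_homo (s : seq nat) (K : nat -> nat) (i j : nat) :
  i \in s -> K i < K j -> rank s K i < rank s K j.
Proof.
move=> si lt; apply: (@sub_count_lt _ _ _ i); rewrite ?ltnn //.
by move=> x /= /ltn_trans ->.
Qed.

Lemma ltn_rank (s : seq nat) (K : nat -> nat) (i j : nat) :
  i \in s -> (rank s K i < rank s K j) = (K i < K j).
Proof.
move=> si; apply/idP/idP; last exact: rank_homo.
apply: contraTT; rewrite -leqNgt => le; rewrite -leqNgt.
by apply: sub_count => x /= lt; apply: leq_trans lt le.
Qed.

Lemma rank_lt_size (s : seq nat) (K : nat -> nat) (i : nat) :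
  i \in s -> rank s K i < size s.
Proof.
move=> si; rewrite -(@count_predT _ s).
by apply: (@sub_count_lt _ _ _ i); rewrite //= ltnn.
Qed.

Lemma rank_inj (s : seq nat) (K : nat -> nat) :
  {in s &, injective K} -> {in s &, injective (rank s K)}.
Proof.
move=> Kinj i j si sj e; apply: Kinj => //.
case: (ltngtP (K i) (K j)) => // lt.
  by have := rank_homo si lt; rewrite e ltnn.
by have := rank_homo sj lt; rewrite e ltnn.
Qed.

Lemma perm_rank (s : seq nat) (K : nat -> nat) :
    uniq s -> {in s &, injective K} ->
  perm_eq [seq rank s K i | i <- s] (iota 0 (size s)).
Proof.
move=> us Kinj; have ur : uniq [seq rank s K i | i <- s].
  by rewrite map_inj_in_uniq //; apply: rank_inj.
apply: uniq_perm; rewrite ?iota_uniq //.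
have [] // := uniq_min_size ur (s2 := iota 0 (size s)); last first.
  by rewrite size_iota size_map.
by move=> _ /mapP[i si ->]; rewrite mem_iota rank_lt_size.
Qed.

Lemma exists_rank (s : seq nat) (K : nat -> nat) (k : nat) :
    uniq s -> {in s &, injective K} -> k < size s ->
  exists2 i, i \in s & rank s K i = k.
Proof.
move=> us Kinj ltk; have : k \in [seq rank s K i | i <- s].
  by rewrite (perm_mem (perm_rank us Kinj)) mem_iota.
by case/mapP=> i si ->; exists i.
Qed.

Lemma rank_rev (s : seq nat) (K K' : nat -> nat) (m : nat) :
    uniq s -> {in s &, injective K} ->
    {in s &, forall i j, (K' i < K' j) = (K j < K i)} -> m \in s ->
  rank s K' m + (rank s K m).+1 = size s.
Proof.
move=> us Kinj eK sm; rewrite /rank -(count_predC (fun j => K' j < K' m)).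
congr (_ + _); rewrite -addn1 -(_ : count_mem m s = 1); last first.
  by rewrite count_uniq_mem // sm.
rewrite -count_predUI [X in _ + X](_ : _ = 0) ?addn0; last first.
  apply/eqP; rewrite -leqn0 leqNgt -has_count; apply/hasPn => j sj /=.
  by apply/negP => /andP[lt' /eqP e]; rewrite e ltnn in lt'.
apply: eq_in_count => j sj /=.
rewrite eK // -leqNgt [RHS]leq_eqVlt [RHS]orbC; congr (_ || _).
by apply/eqP/eqP => [->//|/Kinj]; apply.
Qed.

(** [Q] is the word [w] with its letters sorted by increasing key [K]. *)
Definition sweeps (n : nat) (K : nat -> nat) (w Q : seq bool) : Prop :=
  size Q = n /\
  forall m, m < n -> nth east Q (rank (iota 0 n) K m) = nth east w m.

Section Sweep.
Variables (n : nat) (K : nat -> nat) (w Q : seq bool).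
Hypothesis Kinj : {in iota 0 n &, injective K}.
Hypothesis KQ : sweeps n K w Q.

Lemma count_take_sweep c k : k <= n ->
  count_mem c (take k Q) =
  count (fun m => (nth east w m == c) && (rank (iota 0 n) K m < k)) (iota 0 n).
Proof.
move=> lek; have [sQ eQ] := KQ.
transitivity (count (fun i => (nth east Q i == c) && (i < k)) (iota 0 n)).
  rewrite -[in LHS](mkseq_nth east Q) /mkseq sQ -map_take count_map take_iota.
  have -> : minn k n = k by lia.
  have -> : n = k + (n - k) by lia.
  rewrite iotaD count_cat -[LHS]addn0; congr (_ + _).
    by apply: eq_in_count => i; rewrite mem_iota /= => ->; rewrite andbT.
  apply/esym/eqP; rewrite -leqn0 leqNgt -has_count; apply/hasPn => i.
  by rewrite mem_iota negb_and; lia.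
have := perm_rank (iota_uniq 0 n) Kinj; rewrite size_iota => /seq.permP <-.
rewrite count_map; apply: eq_in_count => m; rewrite mem_iota => /= lt.
by rewrite eQ.
Qed.

Lemma step_line_sweep m : m < n ->
  step_line Q (rank (iota 0 n) K m) =
  count (fun m' => (nth east w m' == nth east w m) && (K m' < K m)) (iota 0 n).
Proof.
move=> lt; have [sQ eQ] := KQ; rewrite /step_line eQ // count_take_sweep; last first.
  by apply: ltnW; rewrite -[X in _ < X](size_iota 0) rank_lt_size // mem_iota.
by apply: eq_in_count => m' im'; rewrite ltn_rank.
Qed.

(** Prefixes of a sorted word are the sets of steps with key below a threshold. *)
Lemma sweep_dyck a b : n = a + b -> w \in dyck a b ->
    (forall t, a * count (fun m => (nth east w m == east) && (K m < t)) (iota 0 n) <=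
               b * count (fun m => (nth east w m == north) && (K m < t)) (iota 0 n)) ->
  Q \in dyck a b.
Proof.
move=> en wD le; have [sQ eQ] := KQ.
have tot c : count_mem c Q = count_mem c w.
  rewrite -[in LHS](take_size Q) sQ count_take_sweep //.
  rewrite -[in RHS](mkseq_nth east w) /mkseq count_map (size_dyck wD) -en.
  apply: eq_in_count => m im /=.
  by rewrite -[X in _ < X](size_iota 0) rank_lt_size // andbT.
rewrite unfold_in; apply/and3P; split.
- by rewrite tot (dyck_count_east wD).
- by rewrite tot (dyck_count_north wD).
apply/allP => k; rewrite mem_iota sQ /= add0n ltnS => lek.
rewrite /easts /norths; case: (ltnP k n) => [ltk|gek]; last first.
  by rewrite !take_oversize ?sQ // !tot (dyck_count_east wD) (dyck_count_north wD) mulnC.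
have [|m0 im0 <-] := @exists_rank (iota 0 n) K k (iota_uniq _ _) Kinj.
  by rewrite size_iota.
have lem0 : rank (iota 0 n) K m0 <= n.
  by apply: ltnW; rewrite -[X in _ < X](size_iota 0) rank_lt_size.
rewrite !count_take_sweep //; have := le (K m0).
by congr (_ * _ <= _ * _); apply: eq_in_count => m im; rewrite ltn_rank.
Qed.

Lemma sweep_rev K' :
    (forall i j, i < n -> j < n -> (K' i < K' j) = (K j < K i)) ->
  sweeps n K' w (rev Q).
Proof.
move=> eK; have [sQ eQ] := KQ; split; first by rewrite size_rev.
move=> m lt; have im : m \in iota 0 n by rewrite mem_iota.
suff e : rank (iota 0 n) K' m + (rank (iota 0 n) K m).+1 = n.
  have -> : rank (iota 0 n) K' m = size Q - (rank (iota 0 n) K m).+1 by rewrite sQ; lia.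
  rewrite nth_rev; last by rewrite sQ; lia.
  by rewrite -(eQ m lt) sQ; congr nth; lia.
rewrite -[RHS](size_iota 0); apply: rank_rev; rewrite ?iota_uniq //.
by move=> i j; rewrite !mem_iota; apply: eK.
Qed.

End Sweep.

(** Gamma matches the steps of [Q] and of the rotated [R] that have the same letter
    and the same number of equal letters before them.  When both keys order the
    steps of each kind in the same way, these come from the same step of [w]. *)
Lemma gamma_sweep n K1 K2 w Q R :
    {in iota 0 n &, injective K1} -> {in iota 0 n &, injective K2} ->
    sweeps n K1 w Q -> sweeps n K2 w (rev R) ->
    (forall i j, i < n -> j < n -> nth east w i = nth east w j ->
       (K1 i < K1 j) = (K2 i < K2 j)) ->
  forall m, m < n ->
    gamma Q R (rank (iota 0 n) K1 m) = rank (iota 0 n) K2 m.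
Proof.
move=> inj1 inj2 sw1 sw2 eK m lt; have [sQ eQ] := sw1; have [sR eR] := sw2.
have im : m \in iota 0 n by rewrite mem_iota.
set l := rank _ K2 m; have ltl : l < n.
  by rewrite -[X in _ < X](size_iota 0) rank_lt_size.
rewrite /gamma sR; set p := fun l' => _.
have pl : p l.
  rewrite /p eQ // eR // eqxx.
  rewrite (step_line_sweep inj1 sw1) // (step_line_sweep inj2 sw2) //=.
  apply/eqP/eq_in_count => m'; rewrite mem_iota => /= lt'.
  by case: eqP => //= e; rewrite eK.
have pinj l' : l' < n -> p l' -> l' = l.
  move=> lt' /andP[/eqP e1 /eqP e2]; have /andP[/eqP e1' /eqP e2'] := pl.
  by apply: (step_line_inj (w := rev R)); rewrite ?sR ?e1' ?e2'.
have hp : has p (iota 0 n) by apply/hasP; exists l; rewrite ?mem_iota.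
have ltf : find p (iota 0 n) < n by rewrite -[X in _ < X](size_iota 0) -has_find.
apply: pinj => //.
by have := nth_find 0 hp; rewrite nth_iota.
Qed.

Section Bounding.
Variables (a b : nat) (w : seq bool).
Hypotheses (wD : w \in dyck a b).
Local Notation n := (a + b).
Local Notation N := (steps_of a b w north).
Local Notation E := (steps_of a b w east).

Lemma rank_split K m : rank (iota 0 n) K m = rank N K m + rank E K m.
Proof.
rewrite /rank !count_filter.
elim: (iota 0 n) => //= j s ->.
by case: (nth east w j); rewrite /= ?andbT ?andbF; lia.
Qed.

Lemma size_north_steps : size N = a.
Proof. by rewrite size_steps_of // (dyck_count_north wD). Qed.

(** In a sorted word the position of a north step is the number of north steps
    plus the number of east steps with smaller key.  The former is the row
    climbed by this step, so the hypothesis says that the path bounding [s] climbs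
    every row at the right abscissa. *)
Lemma sweeps_bounding_path K s :
    {in iota 0 n &, injective K} ->
    {in N, forall m, nth 0 s (a - (rank N K m).+1) = rank E K m} ->
  sweeps n K w (bounding_path a b s).
Proof.
move=> Kinj es; split; first by rewrite size_mkseq.
move=> m lt; have im : m \in iota 0 n by rewrite mem_iota.
have subN : {subset N <= iota 0 n} by move=> x; rewrite mem_filter => /andP[].
rewrite nth_mkseq; last by rewrite -[X in _ < X](size_iota 0) rank_lt_size.
suff -> : (rank (iota 0 n) K m \in [seq r + nth 0 s (a - r.+1) | r <- iota 0 a])
   = (nth east w m == north) by case: (nth east w m).
apply/mapP/idP => [[r]|em].
  rewrite mem_iota /= add0n => ltr e.
  have [||m' Nm' er] := @exists_rank N K r (filter_uniq _ (iota_uniq _ _)).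
  - by move=> i j /subN ii /subN ij; apply: Kinj.
  - by rewrite size_north_steps.
  suff -> : m = m' by have := Nm'; rewrite mem_steps_of => /andP[].
  apply: (rank_inj Kinj) => //; first exact: subN.
  by rewrite [RHS]rank_split -es // er.
have Nm : m \in N by rewrite mem_steps_of em.
exists (rank N K m).
  by rewrite mem_iota /= -[X in _ < X]size_north_steps rank_lt_size.
by rewrite es // rank_split.
Qed.

End Bounding.

Lemma eq_from_ltn (x y : nat) : (forall j, (j < x) = (j < y)) -> x = y.
Proof.
move=> e; case: (ltngtP x y) => // lt; first by rewrite -e ltnn in lt.
by rewrite e ltnn in lt.
Qed.

(** The number of [E]-elements below [m] grows with the key of [m]; hence the
    elements of [N] that exceed [j] form a final segment, which contains [m] iff
    its size exceeds the number of other elements of [N] not below [m]. *)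
Lemma ltn_count_rank (N E : seq nat) (K : nat -> nat) (j m : nat) :
    m \in N ->
  (size N - (rank N K m).+1 < count (fun m' => j < rank E K m') N) =
  (j < rank E K m).
Proof.
move=> Nm; have szE P := count_predC P N.
have mono x y : K x <= K y -> rank E K x <= rank E K y.
  by move=> le; apply: sub_count => z /= lt; apply: leq_trans lt le.
have lt := rank_lt_size K Nm.
case: (ltnP j (rank E K m)) => h.
  have := szE (fun m' => K m' < K m); rewrite -/(rank N K m).
  have : count (predC (fun m' => K m' < K m)) N <= count (fun m' => j < rank E K m') N.
    by apply: sub_count => x /=; rewrite -leqNgt => /mono; apply: leq_trans.
  lia.
have := szE (fun m' => j < rank E K m').
have : rank N K m < count (predC (fun m' => j < rank E K m')) N.
  apply: (@sub_count_lt _ _ _ m); rewrite ?ltnn //= -?leqNgt //.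
  by move=> x /= /ltnW /mono le; rewrite -leqNgt (leq_trans le).
lia.
Qed.

(** * Zeta and eta as sorting maps *)

Section ZetaEta.
Variables (a b : nat) (w : seq bool).
Hypotheses (ha : 0 < a) (hb : 0 < b) (hab : coprime a b).
Hypothesis (wD : w \in dyck a b).
Local Notation n := (a + b).
Local Notation L := (level a b w).
Local Notation N := (steps_of a b w north).
Local Notation E := (steps_of a b w east).

Lemma level_le k : L k <= a * b.
Proof.
have : b * norths w k <= b * a by rewrite leq_mul2l (norths_le wD) orbT.
by rewrite /level; lia.
Qed.

Lemma level_start_inj : {in iota 0 n &, injective L}.
Proof. by move=> i j; rewrite !mem_iota /= => li lj; apply: level_inj. Qed.

Lemma level_end_inj : {in iota 0 n &, injective (fun m => L m.+1)}.
Proof.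
move=> i j; rewrite !mem_iota /= !add0n => li lj e.
have n0 : 0 < n by lia.
have z k : k < n -> L k.+1 = L 0 -> k.+1 = n.
  rewrite leq_eqVlt => /predU1P[//|lt] /(level_inj wD ha hb hab lt n0) //.
have [ei|ni] := eqVneq i.+1 n.
  have : j.+1 = n by apply: z; rewrite // -e ei (level_last wD) ?level0.
  by lia.
have [ej|nj] := eqVneq j.+1 n.
  have : i.+1 = n by apply: z; rewrite // e ej (level_last wD) ?level0.
  by lia.
apply: succn_inj; apply: (level_inj wD ha hb hab) => //; lia.
Qed.

(** The [k]-th largest part of lambda belongs to the [k]-th highest north step. *)
Lemma zeta_sweeps : sweeps n L w (zeta a b w).
Proof.
apply: (sweeps_bounding_path wD level_start_inj) => m Nm.
apply: eq_from_ltn => j; rewrite nth_geq_sorted ?sort_geq_sorted //.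
by rewrite (count_lambda wD ha hb hab) -(ltn_count_rank E L j Nm) size_north_steps.
Qed.

Lemma reversed_end_inj : {in iota 0 n &, injective (fun m => a * b - L m.+1)}.
Proof.
move=> i j ii ij e; apply: level_end_inj => //.
by have := level_le i.+1; have := level_le j.+1; lia.
Qed.

(** The word is read from the highest end point down; subtracting the levels from
    the bound [a * b] turns this into an increasing key.  Conjugation exchanges the
    roles of the two kinds of steps: if [k] north steps end below a given one, then
    an east step ends above it iff more than [k] north steps end below that east
    step. *)
Lemma eta_sweeps : sweeps n (fun m => a * b - L m.+1) w (eta a b w).
Proof.
have up x y : (a * b - L x < a * b - L y) = (L y < L x).
  by have := level_le x; have := level_le y; lia.
apply: (sweeps_bounding_path wD reversed_end_inj) => m Nm.
rewrite nth_conjugate (count_mu wD ha hb hab).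
apply: eq_in_count => e Ee; rewrite up.
rewrite -/(rank N (fun m => L m.+1) e).
have -> : a - (rank N (fun m => a * b - L m.+1) m).+1 = rank N (fun m => L m.+1) m.
  have subN x : x \in N -> x \in iota 0 n by rewrite mem_filter => /andP[].
  have Kinj : {in N &, injective (fun m => L m.+1)}.
    by move=> x y /subN ix /subN iy; apply: level_end_inj.
  have sub x y z : y + x.+1 = z -> z - y.+1 = x by lia.
  apply: sub; rewrite -[RHS](size_north_steps wD).
  exact: (rank_rev (filter_uniq _ (iota_uniq 0 n)) Kinj (fun x y _ _ => up x.+1 y.+1) Nm).
by rewrite ltn_rank.
Qed.

Lemma rev_eta_sweeps : sweeps n (fun m => L m.+1) w (rev (eta a b w)).
Proof.
apply: (sweep_rev reversed_end_inj eta_sweeps) => i j _ _.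
by have := level_le i.+1; have := level_le j.+1; lia.
Qed.

(** The level truncated above at [t] is a potential: an east step that starts below
    [t] lowers it by exactly [a], a north step that starts below [t] raises it by at
    most [b], and no other step raises it. *)
Lemma zeta_dyck : zeta a b w \in dyck a b.
Proof.
apply: (sweep_dyck level_start_inj zeta_sweeps erefl wD) => t.
suff : forall k, k <= n -> minn (L k) t
    + a * count (fun m => (nth east w m == east) && (L m < t)) (iota 0 k)
    <= b * count (fun m => (nth east w m == north) && (L m < t)) (iota 0 k).
  by move/(_ n (leqnn n)); lia.
elim=> [|k IHk] ltk; first by rewrite level0 // min0n muln0.
have {IHk} := IHk (ltnW ltk).
rewrite -addn1 iotaD !count_cat /= addn0 !mulnDr.
case ek: (nth east w k); rewrite /= ?addn1 ?add0n ?addn0 ?muln0.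
  by have := level_north wD ltk ek; case: ltnP; lia.
by have := level_east wD ltk ek; case: ltnP; lia.
Qed.

(** The same argument with the level truncated below at [u], applied to the steps
    that end at level [u] or higher. *)
Lemma eta_dyck : eta a b w \in dyck a b.
Proof.
apply: (sweep_dyck reversed_end_inj eta_sweeps erefl wD) => t.
(* As levels are at most [a * b], the key [a * b - x] is below [t] iff [u <= x]. *)
pose u := (a * b).+1 - t.
suff : forall k, k <= n -> maxn (L k) u
    + a * count (fun m => (nth east w m == east) && (a * b - L m.+1 < t)) (iota 0 k)
    <= u + b * count (fun m => (nth east w m == north) &&
                               (a * b - L m.+1 < t)) (iota 0 k).
  by move/(_ n (leqnn n)); lia.
elim=> [|k IHk] ltk; first by rewrite level0 // max0n !muln0.
have {IHk} := IHk (ltnW ltk).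
have := level_le k.+1; rewrite /u.
rewrite -addn1 iotaD !count_cat /= addn0 !mulnDr.
case ek: (nth east w k); rewrite /= ?addn1 ?add0n ?addn0 ?muln0.
  by have := level_north wD ltk ek; case: ltnP; lia.
by have := level_east wD ltk ek; case: ltnP; lia.
Qed.

(** * The permutation gamma follows the path *)

Local Notation pos := (rank (iota 0 n) L).

(** The path is closed for the level, so its end points carry the same levels as
    its starting points. *)
Lemma rank_ends m : rank (iota 0 n) (fun m => L m.+1) m = pos m.+1.
Proof.
rewrite /rank -(count_map S (fun x => L x < L m.+1)) -(iotaDl 1 0).
have := congr1 (count (fun x => L x < L m.+1)) (iotaD 0 n 1).
by rewrite addn1 count_cat /= add0n level0 level_last // addn0 addnC => /addIn.
Qed.

Lemma pos_lt i : i < n -> pos i < n.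
Proof. by move=> lt; rewrite -[X in _ < X](size_iota 0) rank_lt_size // mem_iota. Qed.

Lemma pos_last : pos n = 0.
Proof.
rewrite /rank (level_last wD) //; apply/eqP; rewrite -leqn0 leqNgt -has_count.
by apply/hasPn.
Qed.

Lemma pos0 : pos 0 = 0.
Proof. by rewrite -[RHS]pos_last /rank (level_last wD) level0. Qed.

(** Steps of the same kind have the same displacement in level, so their order by
    start is their order by end. *)
Lemma gamma_pos m : m < n -> gamma (zeta a b w) (eta a b w) (pos m) = pos m.+1.
Proof.
move=> lt; rewrite -rank_ends.
apply: (gamma_sweep level_start_inj level_end_inj zeta_sweeps rev_eta_sweeps) => //.
move=> i j li lj e; case ei: (nth east w i) (e) => /esym ej.
  by rewrite (level_north wD li ei) (level_north wD lj ej) ltn_add2r.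
by rewrite (level_east wD li ei) (level_east wD lj ej) ltn_add2r.
Qed.

Lemma iter_gamma m : m <= n -> iter m (gamma (zeta a b w) (eta a b w)) 0 = pos m.
Proof.
elim: m => [|m IHm] lt; first by rewrite pos0.
by rewrite iterS IHm ?gamma_pos // ltnW.
Qed.

(** The entries of sigma are the ranks of the levels met along [w], so its descents
    are the drops in level. *)
Lemma iota_map_zeta_eta : iota_map a b (zeta a b w) (eta a b w) = w.
Proof.
apply: (@eq_from_nth _ east); rewrite size_mkseq ?(size_dyck wD) // => i lt.
rewrite nth_mkseq // /cyclic_descent /sigma size_traject.
have n0 : 0 < n by lia.
rewrite !nth_traject ?ltn_pmod // !iter_gamma ?(ltnW lt) //; last first.
  by rewrite ltnW ?ltn_pmod.
have -> : pos (i.+1 %% n) = pos i.+1.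
  move: lt; rewrite leq_eqVlt => /predU1P[->|lt]; first by rewrite modnn pos0 pos_last.
  by rewrite modn_small.
rewrite -[pos i.+1]rank_ends.
case ei: (nth east w i).
  have -> // : rank (iota 0 n) (fun m => L m.+1) i < pos i = false.
  apply/negbTE; rewrite -leqNgt rank_ends; apply: sub_count => x /=.
  by rewrite (level_north wD lt ei); lia.
have -> // : rank (iota 0 n) (fun m => L m.+1) i < pos i.
rewrite rank_ends; have e := level_east wD lt ei.
case: (ltngtP i.+1 n) => [lt'|gt|en]; [|lia|].
  by rewrite ltn_rank ?mem_iota // e; lia.
rewrite en pos_last -[X in X < _]pos0 ltn_rank ?mem_iota //.
by rewrite level0 e; lia.
Qed.

(** Every label is the rank of some point of the path, hence is reached from 0. *)
Lemma gamma_single_cycle : single_cycle n (gamma (zeta a b w) (eta a b w)).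
Proof.
set g := gamma _ _; have n0 : 0 < n by lia.
have exp (i : 'I_n) : exists2 m, m < n & pos m = i.
  have [|m im <-] := @exists_rank (iota 0 n) L i (iota_uniq _ _) level_start_inj.
    by rewrite size_iota.
  by exists m => //; move: im; rewrite mem_iota.
have posS m : m < n -> pos m.+1 < n.
  rewrite leq_eqVlt => /predU1P[->|]; last exact: pos_lt.
  by rewrite pos_last.
have g_lt (i : 'I_n) : g i < n.
  by have [m lt <-] := exp i; rewrite /g gamma_pos ?posS.
pose f (i : 'I_n) := Ordinal (g_lt i).
have f_inj : injective f.
  move=> i j /(congr1 val) /= e; apply: val_inj => /=.
  have [m lm em] := exp i; have [m' lm' em'] := exp j.
  move: e; rewrite -em -em' /g !gamma_pos // -!rank_ends => e.
  congr pos; apply: (rank_inj level_end_inj); rewrite ?mem_iota //.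
exists (perm f_inj); split; first by move=> i; rewrite permE.
set s := perm f_inj.
pose o := Ordinal n0.
have sXo m : m <= n -> (s ^+ m)%g o = pos m :> nat.
  elim: m => [|m IHm] lt; first by rewrite expg0 perm1 pos0.
  by rewrite expgSr permM permE /= IHm /g ?gamma_pos // ltnW.
have orb i : i \in porbit s o.
  have [m lm em] := exp i; apply/porbitP; exists m; apply: val_inj => /=.
  by rewrite sXo ?em // ltnW.
have orbT i : porbit s i = setT.
  have -> : porbit s i = porbit s o by apply/eqP; rewrite eq_porbit_mem.
  by apply/setP => j; rewrite orb inE.
apply/setP => A; rewrite inE; apply/imsetP/eqP => [[i _ ->]|->] //.
by exists o; rewrite ?orbT.
Qed.

End ZetaEta.

Theorem theorem6p3 (a b : nat) (ha : 0 < a) (hb : 0 < b) (hab : coprime a b) :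
  [/\ forall Q R : seq bool, admissible a b Q R ->
        [/\ Q \in dyck a b, R \in dyck a b, single_cycle (a + b) (gamma Q R)
          & iota_map a b Q R \in dyck a b],
      forall P : seq bool, P \in dyck a b ->
        iota_map a b (zeta a b P) (eta a b P) = P
    & forall Q R : seq bool, admissible a b Q R ->
        (zeta a b (iota_map a b Q R), eta a b (iota_map a b Q R)) = (Q, R)].
Proof.
split=> [Q R [P PD [-> ->]]|P PD|Q R [P PD [-> ->]]].
- split; [exact: zeta_dyck|exact: eta_dyck|exact: gamma_single_cycle|].
  by rewrite iota_map_zeta_eta.
- exact: iota_map_zeta_eta.
by rewrite iota_map_zeta_eta.
Qed.
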